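(* For every $m\in\mathbb{N}$, the $m$-OGP for the random $k$-SAT model exhibits a sharp phase transition at $\gamma_{\mathrm{k-SAT}}(m)=1/m$, that is, \[ \sup\{\gamma>0:\gamma\text{ is }m\text{-admissible}\}=\frac1m=\inf\{\gamma>0:\gamma\text{ is }m\text{-inadmissible}\}. \]
   Context: Random $k$-SAT: given Boolean variables $x_1,\dots,x_n$, a random $k$-clause is a disjunction $\mathcal{C}=y_1\vee\cdots\vee y_k$ whose literals $y_1,\dots,y_k$ are drawn independently and uniformly (with replacement) from $\{x_1,\dots,x_n,\bar x_1,\dots,\bar x_n\}$. A random $k$-SAT formula with $M$ clauses is $\Phi=\mathcal{C}_1\wedge\cdots\wedge\mathcal{C}_M$ with independent random $k$-clauses. For $\sigma\in\{0,1\}^n$, $\Phi(\sigma)\in\{0,1\}$ is the truth value of $\Phi$ under the assignment $\sigma$. For $\gamma>0$, take $M=\lfloor\alpha_\gamma n\rfloor$ with $\alpha_\gamma=\gamma 2^k\ln 2$. Let $d_H(\sigma,\sigma')=|\{i\le n:\sigma(i)\ne\sigma'(i)\}|$. $\mathcal{S}_{\mathrm{k-SAT}}(\gamma,m,\xi,\eta)$ is the (random) set of all $m$-tuples $(\sigma^{(1)},\dots,\sigma^{(m)})$ of elements of $\{0,1\}^n$ such that (i) $\Phi(\sigma^{(t)})=1$ for all $1\le t\le m$, and (ii) $n^{-1}d_H(\sigma^{(t)},\sigma^{(\ell)})\in[\xi-\eta,\xi]$ for all $1\le t<\ell\le m$. Fix $m\in\mathbb{N}$. A value $\gamma>0$ is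 called $m$-admissible if for every $0<\eta<\xi\le\frac12$ there exists $C(\gamma,m,\xi,\eta)\in\mathbb{N}$ such that for every sequence of integers $k=k(n)\ge C(\gamma,m,\xi,\eta)\ln n$, $\lim_{n\to\infty}\mathbb{P}[\mathcal{S}_{\mathrm{k-SAT}}(\gamma,m,\xi,\eta)\neq\varnothing]=1$. A value $\gamma>0$ is called $m$-inadmissible if there exist $0<\eta<\xi\le\frac12$ and $C(\gamma,m,\xi,\eta)\in\mathbb{N}$ such that for every sequence of integers $k=k(n)\ge C(\gamma,m,\xi,\eta)\ln n$, $\lim_{n\to\infty}\mathbb{P}[\mathcal{S}_{\mathrm{k-SAT}}(\gamma,m,\xi,\eta)\neq\varnothing]=0$. *)

(* Defs.v *)
From mathcomp Require Import all_boot all_order all_algebra.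
From mathcomp Require Import all_classical all_reals all_analysis.
Import Order.TTheory GRing.Theory Num.Theory.
Import numFieldNormedType.Exports.

Set Implicit Arguments.
Unset Strict Implicit.
Unset Printing Implicit Defensive.

Local Open Scope classical_set_scope.
Local Open Scope ring_scope.

Definition assignment (n : nat) : finType := {ffun 'I_n -> bool}.

(* (i, true) is the variable x_i and (i, false) is its negation. *)
Definition literal (n : nat) : finType := ('I_n * bool)%type.

Definition clause (n k : nat) : finType := {ffun 'I_k -> literal n}.

Definition formula (n k M : nat) : finType := {ffun 'I_M -> clause n k}.

Definition sat_literal n (s : assignment n) (y : literal n) : bool :=
  s y.1 == y.2.

Definition sat_clause n k (s : assignment n) (c : clause n k) : bool :=
  [exists j, sat_literal s (c j)].

Definition sat_formula n k M (s : assignment n) (Phi : formula n k M) : bool :=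
  [forall a, sat_clause s (Phi a)].

Definition hamming n (s t : assignment n) : nat := #|[set i | s i != t i]%SET|.

Definition literal_law (R : realType) n (y : literal n) : R :=
  #|literal n|%:R^-1.

(* The k * M literals are independent, so the law of the formula is the
   product of the uniform laws of its literals. *)
Definition formula_law (R : realType) n k M (Phi : formula n k M) : R :=
  \prod_(a < M) \prod_(j < k) literal_law R (Phi a j).

Definition Prob (R : realType) n k M (E : {set formula n k M}) : R :=
  \sum_(Phi in E) formula_law R Phi.

Definition solution_tuples (R : realType) n k M (m : nat) (xi eta : R)
    (Phi : formula n k M) : {set {ffun 'I_m -> assignment n}} :=
  [set s : {ffun 'I_m -> assignment n} |
    [forall t, sat_formula (s t) Phi] &&
    [forall t : 'I_m, forall l : 'I_m, (t < l)%N ==>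
      (xi - eta <= n%:R^-1 * (hamming (s t) (s l))%:R <= xi)]]%SET.

Definition alpha (R : realType) (gamma : R) (k : nat) : R :=
  gamma * 2 ^+ k * ln 2.

(* For nonnegative arguments, truncn is the floor, as a natural number. *)
Definition num_clauses (R : realType) (gamma : R) (n k : nat) : nat :=
  Num.truncn (alpha gamma k * n%:R).

Definition prob_solution_tuples (R : realType) (gamma : R) (m : nat)
    (xi eta : R) (n k : nat) : R :=
  Prob R [set Phi : formula n k (num_clauses gamma n k) |
           solution_tuples m xi eta Phi != finset.set0]%SET.

Definition admissible (R : realType) (m : nat) (gamma : R) : Prop :=
  forall xi eta : R, 0 < eta -> eta < xi -> xi <= 2^-1 ->
  exists C : nat, forall k : nat -> nat,
    (forall n, (0 < n)%N -> C%:R * ln (n%:R : R) <= (k n)%:R) ->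
    prob_solution_tuples gamma m xi eta n (k n) @[n --> \oo] --> (1 : R).

Definition inadmissible (R : realType) (m : nat) (gamma : R) : Prop :=
  exists xi eta : R, [/\ 0 < eta, eta < xi & xi <= 2^-1] /\
  exists C : nat, forall k : nat -> nat,
    (forall n, (0 < n)%N -> C%:R * ln (n%:R : R) <= (k n)%:R) ->
    prob_solution_tuples gamma m xi eta n (k n) @[n --> \oo] --> (0 : R).

(* Main.v *)
(* Fix a pattern tau of m assignments with the required distances.  Its 2^n
   translates sigma xor tau have the same distances, and a random clause is
   violated by some member of a translate with a probability q <= m 2^-k that
   does not depend on sigma.  For gamma < 1/m the second moment method applies
   to the number of satisfying translates: if all distances between two
   translates are >= delta n, a random clause is violated by both with
   probability at most m^2 2^-k (1 - delta)^k, which is o(2^-k / n) once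
   k >= C ln n, so such a pair contributes a factor 1 + o(1); the other pairs
   are a fraction <= m^2 2^-n exp(eps n) of all, which beats their contribution
   (1 - q)^-M ~ 2^(m gamma n).
   For gamma > 1/m the first moment method suffices: if xi is small there are
   only 2^n exp(eps n) candidate tuples, and each of them is satisfying with
   probability 2^-(m gamma n) up to a factor exp(eps n), because by Bonferroni
   q = (m - o(1)) 2^-k. *)

Require Import Defs.
From mathcomp Require Import all_boot all_order all_algebra.
From mathcomp Require Import all_classical all_reals all_analysis.
From mathcomp Require Import ring lra.
Import Order.TTheory GRing.Theory Num.Theory.
Import numFieldNormedType.Exports.
Local Open Scope classical_set_scope.
Local Open Scope ring_scope.

(** * Uniform probabilities of formulas and of clauses *)

Lemma natr_card (R : pzSemiRingType) (T : finType) (A : {set T}) :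
  #|A|%:R = \sum_x (x \in A)%:R :> R.
Proof.
rewrite -sum1_card natr_sum big_mkcond/=.
by apply: eq_bigr => x _; case: (x \in A).
Qed.

Lemma ProbE (R : realType) n k M (E : {set formula n k M}) :
  Prob R E = #|E|%:R / #|formula n k M|%:R.
Proof.
rewrite /Prob (eq_bigr (fun=> #|formula n k M|%:R^-1)).
  by rewrite sumr_const mulr_natl.
move=> Phi _; rewrite /formula_law /literal_law.
under eq_bigr do rewrite prodr_const card_ord.
by rewrite prodr_const card_ord !card_ffun !card_ord !natrX -!exprVn.
Qed.

Lemma card_clause n k : #|clause n k| = ((2 * n) ^ k)%N.
Proof. by rewrite card_ffun !card_ord [#|_|]card_prod card_ord card_bool mulnC. Qed.

Definition clause_prob (R : realType) {n k} (G : {set clause n k}) : R :=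
  #|G|%:R / #|clause n k|%:R.

Lemma clause_gt0 n k : (0 < n)%N -> (0 < #|clause n k|)%N.
Proof. by move=> n0; rewrite card_clause expn_gt0 muln_gt0 n0. Qed.

Lemma formula_gt0 n k M : (0 < n)%N -> (0 < #|formula n k M|)%N.
Proof. by move=> n0; rewrite card_ffun expn_gt0 clause_gt0. Qed.

(** Independence of the clauses: the event consists of all functions into [G], so it has [#|G| ^ M]
    elements. *)
Lemma Prob_forall_clauses (R : realType) n k M (G : {set clause n k}) :
  Prob R [set Phi : formula n k M | [forall a, Phi a \in G]]%SET =
  clause_prob R G ^+ M.
Proof.
rewrite ProbE /clause_prob expr_div_n -!natrX (card_ffun 'I_M) card_ord.
congr (_%:R / _); rewrite -[M in RHS]card_ord -card_ffun_on cardsE.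
by apply: eq_card => Phi; apply/forallP/ffun_onP.
Qed.

Definition violating {n} k {m} (s : 'I_m -> assignment n) : {set clause n k} :=
  [set c | [exists t, ~~ sat_clause (s t) c]]%SET.

Lemma all_sat_formulaE n k M m (s : 'I_m -> assignment n) (Phi : formula n k M) :
  [forall t, sat_formula (s t) Phi] = [forall a, Phi a \in ~: violating k s]%SET.
Proof.
apply/forallP/forallP => h.
  move=> a; rewrite !inE negb_exists; apply/forallP => t; rewrite negbK.
  by move/forallP: (h t).
move=> t; apply/forallP => a; move: (h a); rewrite !inE negb_exists.
by move=> /forallP/(_ t); rewrite negbK.
Qed.

Definition violating2 {n} k (s t : assignment n) : {set clause n k} :=
  [set c | ~~ sat_clause s c && ~~ sat_clause t c]%SET.

Lemma card_agree n (s t : assignment n) :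
  #|[set i | s i == t i]%SET| = (n - hamming s t)%N.
Proof.
rewrite [LHS]cardsCs card_ord; congr (_ - _)%N; apply: eq_card => i.
by rewrite !inE.
Qed.

Lemma hamming_le n (s t : assignment n) : (hamming s t <= n)%N.
Proof. by rewrite -[X in (_ <= X)%N]card_ord max_card. Qed.

(** A literal false under both [s] and [t] is [(i, ~~ s i)] with [s i = t i]. The clauses counted
    are thus the functions into a set [L] with one literal per coordinate of agreement. *)
Lemma card_violating2 n k (s t : assignment n) :
  #|violating2 k s t| = ((n - hamming s t) ^ k)%N.
Proof.
pose L := [set (i, ~~ s i) | i in [set i | s i == t i]]%SET.
have -> : violating2 k s t = [set c : clause n k | c \in ffun_on (mem L)]%SET.
  apply/setP => c; rewrite !inE /sat_clause !negb_exists.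
  apply/andP/ffun_onP => [[/forallP hs /forallP ht] j|h].
    apply/imsetP; exists (c j).1.
      rewrite inE; move: (hs j) (ht j); rewrite /sat_literal.
      by case: (s _); case: (t _); case: (c j).2.
    move: (hs j); rewrite /sat_literal.
    by case: (c j) => i [] /=; case: (s i).
  split; apply/forallP => j; move: (h j) => /imsetP[i]; rewrite inE => /eqP e ->;
    rewrite /sat_literal /= -?e; by case: (s i).
rewrite cardsE card_ffun_on card_ord; congr (_ ^ _)%N.
by rewrite card_imset ?card_agree// => i j [].
Qed.

Lemma hammingxx n (s : assignment n) : hamming s s = 0%N.
Proof. by apply/eqP; rewrite cards_eq0; apply/eqP/setP => i; rewrite !inE eqxx. Qed.

Lemma hammingC n (s t : assignment n) : hamming s t = hamming t s.
Proof. by apply: eq_card => i; rewrite !inE eq_sym. Qed.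

Section clause_prob_theory.
Variables (R : realType) (n k : nat).
Hypothesis n0 : (0 < n)%N.
Implicit Types G H : {set clause n k}.

Let c0 : 0 < #|clause n k|%:R :> R.
Proof. by rewrite ltr0n clause_gt0. Qed.

Lemma clause_prob_ge0 G : 0 <= clause_prob R G.
Proof. by rewrite divr_ge0. Qed.

Lemma clause_prob_le1 G : clause_prob R G <= 1.
Proof. by rewrite ler_pdivrMr// mul1r ler_nat max_card. Qed.

Lemma clause_probC G : clause_prob R (~: G)%SET = 1 - clause_prob R G.
Proof.
apply/eqP; rewrite eq_sym subr_eq -mulrDl -natrD addnC cardsC divff//.
by rewrite gt_eqF.
Qed.

Lemma clause_probU G H : clause_prob R (G :|: H)%SET =
  clause_prob R G + clause_prob R H - clause_prob R (G :&: H)%SET.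
Proof. by rewrite -mulrDl -mulrBl -natrD -cardsUI natrD addrK. Qed.

Lemma clause_prob_violating2 (s t : assignment n) :
  clause_prob R (violating2 k s t) = ((1 - (hamming s t)%:R / n%:R) / 2) ^+ k.
Proof.
rewrite /clause_prob card_violating2 card_clause !natrX -expr_div_n; congr (_ ^+ _).
have nn0 : n%:R != 0 :> R by rewrite pnatr_eq0 -lt0n.
rewrite natrB ?hamming_le// natrM; field; exact: nn0.
Qed.

Lemma clause_prob_sumE G : clause_prob R G =
  (\sum_(c : clause n k) (c \in G)%:R) / #|clause n k|%:R.
Proof. by rewrite /clause_prob natr_card. Qed.

(** Union bound over the [m ^ 2] pairs, checked clause by clause. *)
Lemma clause_prob_violatingI_le m (s s' : 'I_m -> assignment n) (b : R) :
  (forall t l, clause_prob R (violating2 k (s t) (s' l)) <= b) ->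
  clause_prob R (violating k s :&: violating k s')%SET <= (m ^ 2)%:R * b.
Proof.
move=> hb; apply: (@le_trans _ _
  (\sum_t \sum_l clause_prob R (violating2 k (s t) (s' l)))).
  rewrite clause_prob_sumE.
  under [X in _ <= X]eq_bigr do under eq_bigr do rewrite clause_prob_sumE.
  under [X in _ <= X]eq_bigr do rewrite -mulr_suml.
  rewrite -mulr_suml ler_pM2r ?invr_gt0//.
  under [X in _ <= X]eq_bigr do rewrite exchange_big/=.
  rewrite [X in _ <= X]exchange_big/=; apply: ler_sum => c _.
  rewrite !inE; case: andP => [[/existsP[t ht] /existsP[l hl]]|_]/=; last first.
    by apply: sumr_ge0 => t _; apply: sumr_ge0.
  rewrite (bigD1 t)//= (bigD1 l)//= !inE ht hl -addrA lerDl addr_ge0//.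
    exact: sumr_ge0.
  by apply: sumr_ge0 => ? _; apply: sumr_ge0.
apply: (@le_trans _ _ (\sum_(t < m) \sum_(l < m) b)).
  by apply: ler_sum => t _; apply: ler_sum.
by rewrite !sumr_const card_ord -mulrnA mulnn mulr_natl.
Qed.

Lemma clause_prob_violating_le m (s : 'I_m -> assignment n) :
  clause_prob R (violating k s) <= m%:R * 2^-1 ^+ k.
Proof.
have -> : m%:R * 2^-1 ^+ k = \sum_t clause_prob R (violating2 k (s t) (s t)).
  under eq_bigr do rewrite clause_prob_violating2 hammingxx mul0r subr0 div1r.
  by rewrite sumr_const card_ord mulr_natl.
rewrite clause_prob_sumE.
under [X in _ <= X]eq_bigr do rewrite clause_prob_sumE.
rewrite -mulr_suml ler_pM2r ?invr_gt0// [X in _ <= X]exchange_big/=; apply: ler_sum => c _.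
rewrite !inE; case: existsP => [[t ht]|_]/=; last exact: sumr_ge0.
by rewrite (bigD1 t)//= !inE ht lerDl sumr_ge0.
Qed.

(* Pointwise this is the inequality 1 >= j - j (j - 1) for an integer j >= 1. *)
Lemma clause_prob_violating_ge m (s : 'I_m -> assignment n) (b : R) : 0 <= b ->
  (forall t l, t != l -> clause_prob R (violating2 k (s t) (s l)) <= b) ->
  m%:R * 2^-1 ^+ k - (m ^ 2)%:R * b <= clause_prob R (violating k s).
Proof.
move=> b0 hb.
have -> : m%:R * 2^-1 ^+ k = \sum_t clause_prob R (violating2 k (s t) (s t)).
  under eq_bigr do rewrite clause_prob_violating2 hammingxx mul0r subr0 div1r.
  by rewrite sumr_const card_ord mulr_natl.
rewrite lerBlDr; apply: (@le_trans _ _ (clause_prob R (violating k s) +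
  \sum_t \sum_(l | t != l) clause_prob R (violating2 k (s t) (s l)))); last first.
  rewrite lerD2l; apply: (@le_trans _ _ (\sum_(t < m) \sum_(l < m) b)).
    apply: ler_sum => t _; rewrite big_mkcond/=; apply: ler_sum => l _.
    by case: ifP => // /hb.
  by rewrite !sumr_const card_ord -mulrnA mulnn mulr_natl.
rewrite [X in _ <= X + _]clause_prob_sumE.
under [X in X <= _]eq_bigr do rewrite clause_prob_sumE.
under [X in _ <= _ + X]eq_bigr do under eq_bigr do rewrite clause_prob_sumE.
under [X in _ <= _ + X]eq_bigr do rewrite -mulr_suml.
rewrite -!mulr_suml -mulrDl ler_pM2r ?invr_gt0// [X in X <= _]exchange_big/=.
under [X in _ <= _ + X]eq_bigr do rewrite exchange_big/=.
rewrite [X in _ <= _ + X]exchange_big/= -big_split/=; apply: ler_sum => c _.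
rewrite !inE; case: existsP => [[t ht]|h]/=; last first.
  rewrite big1 ?add0r ?sumr_ge0// => [|t _].
    by move=> t _; apply: sumr_ge0.
  by rewrite inE; case E: (~~ _) => //=; case: h; exists t; rewrite E.
(* Of the double sum only the row of the violated index [t] is kept; it already equals the remaining
   diagonal terms. *)
rewrite (bigD1 t)//= inE ht lerD2l [X in _ <= X](bigD1 t)//=.
rewrite [leLHS](_ : _ = \sum_(l | t != l) (c \in violating2 k (s t) (s l))%:R).
  by rewrite lerDl; apply: sumr_ge0 => ? _; apply: sumr_ge0.
apply: eq_big => [l|l _]; first by rewrite eq_sym.
by rewrite !inE ht andbb.
Qed.

End clause_prob_theory.

(** * Hamming balls and translations of the cube *)

Lemma chernoff_ball (R : realType) n (t : assignment n) (L r : R) : 0 <= L ->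
  #|[set s : assignment n | (hamming s t)%:R <= r]%SET|%:R <=
    expR (L * r) * (1 + expR (- L)) ^+ n.
Proof.
move=> L0; rewrite natr_card.
(* Exponential Markov inequality: the indicator of the ball is at most
   [expR (L * (r - hamming s t))]. This is a product over the coordinates, so its sum over the cube
   factorizes. *)
apply: (@le_trans _ _ (\sum_(s : assignment n) expR (L * r) *
    \prod_(i < n) (if s i != t i then expR (- L) else 1))).
  apply: ler_sum => s _; rewrite inE.
  rewrite -big_mkcond/= prodr_const.
  rewrite [X in _ ^+ X](_ : _ = hamming s t); last first.
    by rewrite /hamming cardsE; apply: eq_card.
  rewrite -expRM_natr -expRD; case: (boolP (_ <= r)) => [h|_]; last by rewrite expR_ge0.
  apply: (@le_trans _ _ (expR 0)); first by rewrite expR0.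
  by rewrite ler_expR mulNr -mulrBr mulr_ge0// subr_ge0.
rewrite -mulr_sumr ler_pM2l ?expR_gt0//.
rewrite -(bigA_distr_bigA (fun i b => if b != t i then expR (- L) else 1)).
rewrite (eq_bigr (fun=> 1 + expR (- L))) ?prodr_const ?card_ord// => i _.
by rewrite big_bool; case: (t i) => //=; rewrite addrC.
Qed.

Definition shift {n} (u s : assignment n) : assignment n :=
  [ffun i => u i (+) s i].

Lemma shiftC n (u s : assignment n) : shift u s = shift s u.
Proof. by apply/ffunP => i; rewrite !ffunE addbC. Qed.

Lemma shiftK n (u : assignment n) : involutive (shift u).
Proof. by move=> s; apply/ffunP => i; rewrite !ffunE addKb. Qed.

Lemma hamming_shift n (u s t : assignment n) :
  hamming (shift u s) (shift u t) = hamming s t.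
Proof. by apply: eq_card => i; rewrite !inE !ffunE (inj_eq (@addbI _)). Qed.

(** The action on clauses dual to [shift]: negating the variables where [u] is true moves a
    translation from the assignment to the clause. *)
Definition flip_clause {n k} (u : assignment n) (c : clause n k) : clause n k :=
  [ffun j => ((c j).1, u (c j).1 (+) (c j).2)].

Lemma flip_clauseK n k (u : assignment n) : involutive (@flip_clause n k u).
Proof.
move=> c; apply/ffunP => j; rewrite !ffunE /= addKb.
by case: (c j).
Qed.

Lemma sat_flip_clause n k (u s : assignment n) (c : clause n k) :
  sat_clause s (flip_clause u c) = sat_clause (shift u s) c.
Proof.
apply: eq_existsb => j; rewrite /sat_literal !ffunE /=.
by case: (s _); case: (u _); case: (c j).2.
Qed.

(** [flip_clause u] permutes the clauses and carries one violating set onto the other. *)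
Lemma clause_prob_shift (R : realType) n k m (u : assignment n)
    (s : 'I_m -> assignment n) :
  clause_prob R (violating k (fun t => shift u (s t))) =
  clause_prob R (violating k s).
Proof.
rewrite /clause_prob; congr (_%:R / _).
rewrite -(card_imset _ (can_inj (@flip_clauseK n k u))).
rewrite (can2_imset_pre _ (@flip_clauseK n k u) (@flip_clauseK n k u)).
apply: eq_card => c; rewrite !inE; apply: eq_existsb => t.
by rewrite -sat_flip_clause flip_clauseK.
Qed.

(** * Second moment method for the translates of a fixed tuple *)

Lemma second_moment (R : realType) (W S : finType) (A : S -> {set W}) (p : R) :
  (0 < #|W|)%N -> (0 < #|S|)%N -> 0 < p ->
  (forall s, #|A s|%:R = p * #|W|%:R) ->
  #|[set w | [forall s, w \notin A s]]%SET|%:R / #|W|%:R <=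
  (\sum_s \sum_s' #|A s :&: A s'|%SET%:R / #|W|%:R) / (#|S|%:R * p) ^+ 2 - 1.
Proof.
move=> W0 S0 p0 hA; set e := #|S|%:R * p.
have e0 : 0 < e by rewrite mulr_gt0// ltr0n.
have w0 : 0 < #|W|%:R :> R by rewrite ltr0n.
pose X w : R := \sum_s (w \in A s)%:R.
have X1 : \sum_w X w = e * #|W|%:R.
  rewrite exchange_big/=; under eq_bigr do rewrite -natr_card hA.
  by rewrite sumr_const -mulrA mulr_natl.
have X2 : \sum_w X w ^+ 2 = \sum_s \sum_s' #|A s :&: A s'|%SET%:R.
  under [RHS]eq_bigr do under eq_bigr do rewrite natr_card.
  under [RHS]eq_bigr do rewrite exchange_big/=.
  rewrite [RHS]exchange_big/=; apply: eq_bigr => w _.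
  rewrite expr2 mulr_suml; apply: eq_bigr => s _.
  rewrite mulr_sumr; apply: eq_bigr => s' _.
  by rewrite inE; case: (w \in A s); rewrite /= ?mul1r ?mul0r.
(* Chebyshev's inequality: the bound is the mean of [(X / e - 1) ^+ 2], where [X] counts the events
   [A s] that occur and [e] is its mean. Where [X] vanishes, this square is 1. *)
have -> : (\sum_s \sum_s' #|A s :&: A s'|%SET%:R / #|W|%:R) / e ^+ 2 - 1 =
    (\sum_w (X w / e - 1) ^+ 2) / #|W|%:R.
  under eq_bigr do rewrite -mulr_suml.
  rewrite -mulr_suml -X2.
  have -> : \sum_w (X w / e - 1) ^+ 2 =
      (\sum_w X w ^+ 2) / e ^+ 2 - 2 / e * (\sum_w X w) + #|W|%:R.
    rewrite mulr_suml mulr_sumr -sumrB -sum1_card natr_sum -big_split/=.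
    by apply: eq_bigr => w _; field; rewrite gt_eqF.
  rewrite X1; field; by rewrite !gt_eqF.
rewrite ler_pM2r ?invr_gt0// natr_card; apply: ler_sum => w _.
rewrite inE; case: forallP => [h|_]/=; last exact: sqr_ge0.
by rewrite /X big1 ?mul0r ?sub0r ?sqrrN ?expr1n// => s _; rewrite (negbTE (h s)).
Qed.

Definition satisfying {n} k M {m} (s : 'I_m -> assignment n) : {set formula n k M} :=
  [set Phi | [forall t, sat_formula (s t) Phi]]%SET.

Lemma Prob_satisfying (R : realType) n k M m (s : 'I_m -> assignment n) :
  (0 < n)%N ->
  Prob R (satisfying k M s) = (1 - clause_prob R (violating k s)) ^+ M.
Proof.
move=> n0; rewrite -clause_probC// -Prob_forall_clauses; congr Prob.
by apply/setP => Phi; rewrite !inE all_sat_formulaE.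
Qed.

Lemma Prob_satisfyingI (R : realType) n k M m (s s' : 'I_m -> assignment n) :
  (0 < n)%N ->
  Prob R (satisfying k M s :&: satisfying k M s')%SET =
  (1 - clause_prob R (violating k s :|: violating k s')%SET) ^+ M.
Proof.
move=> n0; rewrite -clause_probC// -Prob_forall_clauses; congr Prob.
apply/setP => Phi; rewrite !inE !all_sat_formulaE.
apply/andP/forallP => [[/forallP h /forallP h'] a|h].
  by rewrite finset.setCU inE h h'.
by split; apply/forallP => a; move: (h a); rewrite finset.setCU inE => /andP[].
Qed.

Lemma le_Prob (R : realType) n k M (E F : {set formula n k M}) :
  E \subset F -> Prob R E <= Prob R F.
Proof.
by move=> EF; rewrite !ProbE ler_wpM2r ?invr_ge0// ler_nat subset_leq_card.
Qed.

Lemma Prob_le1 (R : realType) n k M (E : {set formula n k M}) :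
  (0 < n)%N -> Prob R E <= 1.
Proof.
move=> n0; rewrite ProbE ler_pdivrMr ?ltr0n ?formula_gt0// mul1r.
by rewrite ler_nat max_card.
Qed.

Lemma ProbC (R : realType) n k M (E : {set formula n k M}) :
  (0 < n)%N -> Prob R (~: E)%SET = 1 - Prob R E.
Proof.
move=> n0; apply/eqP; rewrite eq_sym subr_eq !ProbE -mulrDl -natrD addnC cardsC.
by rewrite divff// pnatr_eq0 -lt0n formula_gt0.
Qed.

Section translates.
Variables (R : realType) (n k M m : nat) (tau : 'I_m -> assignment n).
Variables (delta B : R).
Hypothesis n0 : (0 < n)%N.
Hypothesis hB : forall t : assignment n,
  #|[set s : assignment n | (hamming s t)%:R <= delta * n%:R]%SET|%:R <= B.

Let T u := fun t => shift u (tau t).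
Let q := clause_prob R (violating k tau).
Let close u u' := [exists t, [exists l,
  (hamming (T u t) (T u' l))%:R <= delta * n%:R]].

Hypothesis q_half : q <= 2^-1.
Hypothesis delta1 : delta <= 1.

Let q0 : 0 <= q. Proof. exact: clause_prob_ge0. Qed.

(** For fixed [t] and [l] the map from [u'] to [T u' l] is injective, so at most [B] values of [u']
    bring it into the ball about [T u t]. *)
Lemma card_close u : #|[set u' | close u u']%SET|%:R <= (m ^ 2)%:R * B.
Proof.
apply: (@le_trans _ _ (\sum_(t < m) \sum_(l < m) B)); last first.
  by rewrite !sumr_const card_ord -mulrnA mulnn mulr_natl.
apply: (@le_trans _ _ (\sum_(t < m) \sum_(l < m)
    #|[set u' : assignment n | (hamming (T u' l) (T u t))%:R <= delta * n%:R]%SET|%:R)).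
  rewrite natr_card; under [leRHS]eq_bigr do under eq_bigr do rewrite natr_card.
  under [leRHS]eq_bigr do rewrite exchange_big/=.
  rewrite [leRHS]exchange_big/=; apply: ler_sum => u' _.
  rewrite inE /close; case: existsP => [[t /existsP[l h]]|_]/=; last first.
    by apply: sumr_ge0 => t _; apply: sumr_ge0.
  rewrite (bigD1 t)//= (bigD1 l)//= inE hammingC h -addrA lerDl addr_ge0//.
    exact: sumr_ge0.
  by apply: sumr_ge0 => ? _; apply: sumr_ge0.
apply: ler_sum => t _; apply: ler_sum => l _; apply: le_trans (hB (T u t)).
rewrite ler_nat -(card_imset _ (can_inj (@shiftK n (tau l)))).
apply: subset_leq_card; apply/fintype.subsetP => _ /imsetP[u' h ->].
by move: h; rewrite !inE shiftC.
Qed.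

(** For a far pair the ratio is [((1 - 2 * q + r) / (1 - q) ^+ 2) ^+ M], where [r] is the
    probability that a clause is violated by both translates; it can exceed 1 only through [r]. For
    a close pair one of the two events is dropped, which leaves [(1 - q) ^- M]. *)
Lemma Prob_pair_le u u' :
  Prob R (satisfying k M (T u) :&: satisfying k M (T u'))%SET / (1 - q) ^+ M ^+ 2 <=
  expR (4 * M%:R * ((m ^ 2)%:R * ((1 - delta) / 2) ^+ k)) +
    (close u u')%:R * (1 - q) ^- M.
Proof.
have q1 : 0 < 1 - q by rewrite subr_gt0 (le_lt_trans q_half)// invf_lt1// ltr1n.
have qE v : clause_prob R (violating k (T v)) = q by exact: clause_prob_shift.
case: (boolP (close u u')) => [_|/negP h].
  rewrite mul1r -[leLHS]add0r lerD ?expR_ge0//.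
  rewrite ler_pdivrMr ?exprn_gt0// expr2 mulKf ?gt_eqF ?exprn_gt0//.
  rewrite -(qE u) -Prob_satisfying//; apply: le_Prob; exact: subsetIl.
rewrite mul0r addr0 Prob_satisfyingI// clause_probU !qE.
set r := clause_prob R _.
have rle : r <= (m ^ 2)%:R * ((1 - delta) / 2) ^+ k.
  apply: clause_prob_violatingI_le => // t l; rewrite clause_prob_violating2//.
  have n0' : 0 < n%:R :> R by rewrite ltr0n.
  rewrite lerXn2r ?nnegrE ?divr_ge0 ?subr_ge0//.
    by rewrite ler_pdivrMr// mul1r ler_nat hamming_le.
  rewrite ler_pM2r ?invr_gt0// lerD2l lerN2 ler_pdivlMr//.
  rewrite leNgt; apply/negP => h'; apply: h; apply/existsP; exists t.
  by apply/existsP; exists l; apply: ltW.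
have r0 : 0 <= r by exact: clause_prob_ge0.
rewrite exprAC -expr_div_n.
have -> : expR (4 * M%:R * ((m ^ 2)%:R * ((1 - delta) / 2) ^+ k)) =
    expR (4 * ((m ^ 2)%:R * ((1 - delta) / 2) ^+ k)) ^+ M.
  by rewrite -expRM_natr; congr expR; ring.
have u1 : 0 <= 1 - (q + q - r).
  by have := clause_prob_le1 R _ _ n0 (violating k (T u) :|: violating k (T u'))%SET;
    rewrite clause_probU !qE -/r subr_ge0.
rewrite lerXn2r ?nnegrE ?expR_ge0 ?divr_ge0 ?sqr_ge0//.
apply: (@le_trans _ _ (1 + 4 * r)).
  rewrite ler_pdivrMr ?exprn_gt0//.
  (* The constant 4 comes from here: [q <= 2^-1] gives [4 * (1 - q) ^+ 2 >= 1]. *)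
  have : 0 <= r * (4 * (1 - q) ^+ 2 - 1).
    rewrite mulr_ge0// subr_ge0; move: q_half; rewrite -[2^-1]mul1r.
    by rewrite ler_pdivlMr// => ?; nra.
  have := sqr_ge0 q; nra.
apply: le_trans (expR_ge1Dx _) _; rewrite ler_expR; lra.
Qed.

Lemma Prob_no_translate :
  Prob R [set Phi : formula n k M |
    [forall u, ~~ [forall t, sat_formula (shift u (tau t)) Phi]]]%SET <=
  expR (4 * M%:R * ((m ^ 2)%:R * ((1 - delta) / 2) ^+ k)) - 1 +
    (m ^ 2)%:R * B * 2^-1 ^+ n * (1 - q) ^- M.
Proof.
have q1 : 0 < 1 - q by rewrite subr_gt0 (le_lt_trans q_half)// invf_lt1// ltr1n.
have S0 : (0 < #|assignment n|)%N by rewrite card_ffun card_bool expn_gt0.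
have S0' : 0 < #|assignment n|%:R :> R by rewrite ltr0n.
have p0 : 0 < (1 - q) ^+ M by rewrite exprn_gt0.
have W0 := @formula_gt0 n k M n0.
have := @second_moment R _ _ (fun u => satisfying k M (T u)) _ W0 S0 p0.
have -> : [set Phi : formula n k M | [forall u, ~~ [forall t,
     sat_formula (shift u (tau t)) Phi]]]%SET =
   [set Phi | [forall u, Phi \notin satisfying k M (T u)]]%SET.
  by apply/setP => Phi; rewrite !inE; apply: eq_forallb => u; rewrite inE.
rewrite ProbE => /(_ _)/le_trans; apply.
- move=> u; have := @Prob_satisfying R n k M m (T u) n0.
  rewrite ProbE clause_prob_shift => /(congr1 ( *%R^~ #|formula n k M|%:R)).
  by rewrite divfK// pnatr_eq0 -lt0n.
set E := expR _.
(* Written as an average over [u], the bound can be compared row by row: every pair gets [E], and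
   the at most [(m ^ 2)%:R * B] close ones get [(1 - q) ^- M] in addition. *)
have -> : E - 1 + (m ^ 2)%:R * B * 2^-1 ^+ n * (1 - q) ^- M =
   (#|assignment n|%:R * (#|assignment n|%:R * E + (m ^ 2)%:R * B * (1 - q) ^- M)) /
    #|assignment n|%:R ^+ 2 - 1.
  have -> : 2^-1 ^+ n = #|assignment n|%:R^-1 :> R.
    by rewrite card_ffun card_bool card_ord natrX exprVn.
  by field; rewrite !gt_eqF.
rewrite lerD2r exprMn invfM [X in _ * X <= _]mulrC mulrA ler_pM2r ?invr_gt0 ?exprn_gt0//.
rewrite mulr_suml.
rewrite [leRHS](_ : _ = \sum_(u : assignment n)
  (#|assignment n|%:R * E + (m ^ 2)%:R * B * (1 - q) ^- M)); last first.
  by rewrite sumr_const mulr_natl.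
apply: ler_sum => u _; rewrite mulr_suml.
apply: (@le_trans _ _ (\sum_u' (E + (close u u')%:R * (1 - q) ^- M))).
  by apply: ler_sum => u' _; rewrite -ProbE; exact: Prob_pair_le.
rewrite big_split/= sumr_const -[E *+ _]mulr_natl lerD2l -mulr_suml.
rewrite ler_pM2r ?invr_gt0//; apply: le_trans (card_close u).
rewrite natr_card; apply: ler_sum => u' _.
by rewrite inE; case: close.
Qed.

End translates.

(** * Tuples of assignments with prescribed distances *)

Lemma sum_modn_blocks (F : nat -> nat) b q : (0 < b)%N ->
  (\sum_(0 <= i < q * b) F (i %% b) = q * \sum_(0 <= j < b) F j)%N.
Proof.
move=> b0; elim: q => [|q IH]; first by rewrite !mul0n big_geq.
rewrite !mulSn addnC (@big_cat_nat _ _ _ (q * b)%N) ?leq_addr//= IH addnC.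
congr (_ + _)%N; rewrite -[X in \sum_(X <= _ < _) _]add0n big_addn ?addnK ?addKn.
rewrite big_nat [RHS]big_nat; apply: eq_bigr => i /andP[_ ib].
by rewrite addnC modnMDl modn_small.
Qed.

(** Flipping the value at [t] exchanges the functions that separate [t] from [l] with those that do
    not. *)
Lemma card_separating m (t l : 'I_m) : t != l ->
  (2 * \sum_(f : {ffun 'I_m -> bool}) (f t != f l) = 2 ^ m)%N.
Proof.
move=> tl; pose g (f : {ffun 'I_m -> bool}) := [ffun i => (i == t) (+) f i].
have gK : involutive g by move=> f; apply/ffunP => i; rewrite !ffunE addKb.
rewrite mul2n -addnn {2}(reindex_inj (can_inj gK))/= -big_split/=.
rewrite (eq_bigr (fun=> 1%N)) => [|f _].
  by rewrite sum1_card card_ffun card_bool card_ord.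
by rewrite !ffunE eqxx eq_sym (eq_sym l) (negbTE tl); case: (f t); case: (f l).
Qed.

(* The first q * 2 ^ m coordinates run q times through all columns in
   {0,1}^m, so any two rows differ on exactly half of them. *)
Definition pattern n {m} q (t : 'I_m) : assignment n :=
  [ffun i : 'I_n => (i < q * 2 ^ m)%N &&
     nth [ffun=> false] (enum {ffun 'I_m -> bool}) (i %% 2 ^ m) t].

Lemma hamming_pattern n m q (t l : 'I_m) : t != l -> (q * 2 ^ m <= n)%N ->
  (2 * hamming (pattern n q t) (pattern n q l) = q * 2 ^ m)%N.
Proof.
move=> tl qn; set c := nth [ffun=> false] (enum {ffun 'I_m -> bool}).
have -> : hamming (pattern n q t) (pattern n q l) =
    (\sum_(i < n) ((i < q * 2 ^ m) && (c (i %% 2 ^ m) t != c (i %% 2 ^ m) l)))%N.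
  rewrite /hamming -sum1_card big_mkcond/=; apply: eq_bigr => i _.
  by rewrite inE !ffunE -/c; case: (i < _)%N => //=; case: (_ != _).
rewrite -(big_mkord xpredT (fun i : nat => nat_of_bool
  ((i < q * 2 ^ m) && (c (i %% 2 ^ m) t != c (i %% 2 ^ m) l))%N)).
rewrite (@big_cat_nat _ _ _ (q * 2 ^ m)%N)//= [X in (_ + X)%N]big_nat.
rewrite [X in (_ + X)%N]big1 ?addn0 => [|i /andP[h _]]; last by rewrite ltnNge h.
rewrite big_nat; under eq_bigr do rewrite andbC.
rewrite (eq_bigr (fun i => nat_of_bool (c (i %% 2 ^ m)%N t != c (i %% 2 ^ m)%N l)))
  => [|i /andP[_ ->]]; last by rewrite andbT.
rewrite -big_nat (@sum_modn_blocks (fun j => c j t != c j l)) ?expn_gt0//.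
rewrite mulnCA; congr (_ * _)%N.
apply: etrans (@card_separating m t l tl); congr (_ * _)%N.
have -> : (2 ^ m = size (enum {ffun 'I_m -> bool}))%N.
  by rewrite -cardE card_ffun card_bool card_ord.
rewrite -(big_nth [ffun=> false] xpredT
  (fun f : {ffun 'I_m -> bool} => nat_of_bool (f t != f l))).
by rewrite big_enum.
Qed.

Definition spread {R : realType} {n m} (xi eta : R) (s : 'I_m -> assignment n) :=
  [forall t : 'I_m, forall l : 'I_m, (t < l)%N ==>
    (xi - eta <= n%:R^-1 * (hamming (s t) (s l))%:R <= xi)].

(** With [q] the largest integer such that [q * 2 ^ m <= 2 * xi * n], all distances in [pattern] are
    at most [xi * n] and miss it by less than [2 ^ m / 2 <= eta * n]. The bound [xi <= 2^-1] ensures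
    that the [q] blocks fit into [n] coordinates. *)
Lemma exists_spread (R : realType) n m (xi eta : R) : (0 < n)%N ->
  0 < xi -> xi <= 2^-1 -> 2 ^+ m <= 2 * eta * n%:R ->
  exists s : 'I_m -> assignment n, spread xi eta s.
Proof.
move=> n0 xi0 xi2 hn; have n0' : 0 < n%:R :> R by rewrite ltr0n.
have b0 : 0 < 2 ^+ m :> R by rewrite exprn_gt0.
have x0 : 0 <= 2 * xi * n%:R / 2 ^+ m by rewrite divr_ge0 ?mulr_ge0// ltW.
pose q := Num.truncn (2 * xi * n%:R / 2 ^+ m).
have /andP[] := truncn_itv x0; rewrite -/q ler_pdivlMr// ltr_pdivrMr// => ql qu.
have qn : (q * 2 ^ m <= n)%N.
  rewrite -(ler_nat R) natrM natrX; apply: le_trans ql _.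
  by rewrite ler_piMl// ?ler0n//; lra.
exists (pattern n q); apply/forallP => t; apply/forallP => l; apply/implyP => tl.
have tl' : t != l by rewrite -val_eqE neq_ltn tl.
have := @hamming_pattern n m q t l tl' qn; set h := hamming _ _.
move=> /(congr1 (fun j => j%:R : R)); rewrite !natrM natrX => hh.
rewrite mulrC ler_pdivlMr// ler_pdivrMr//; move: qu; rewrite -natr1 mulrDl mul1r => qu.
by apply/andP; split; lra.
Qed.

Lemma spread_shift (R : realType) n m (xi eta : R) (s : 'I_m -> assignment n) u :
  spread xi eta (fun t => shift u (s t)) = spread xi eta s.
Proof.
by apply: eq_forallb => t; apply: eq_forallb => l; rewrite hamming_shift.
Qed.

(** * Lower and upper bounds for the probability of a solution tuple *)

Lemma in_solution_tuples (R : realType) n k M m (xi eta : R) (Phi : formula n k M)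
    (s : {ffun 'I_m -> assignment n}) :
  (s \in solution_tuples m xi eta Phi) = (Phi \in satisfying k M s) && spread xi eta s.
Proof. by rewrite !inE. Qed.

Lemma Prob_solution_tuples_ge (R : realType) n k M m (xi eta : R)
    (tau : 'I_m -> assignment n) : (0 < n)%N -> spread xi eta tau ->
  1 - Prob R [set Phi : formula n k M |
      [forall u, ~~ [forall t, sat_formula (shift u (tau t)) Phi]]]%SET <=
  Prob R [set Phi : formula n k M | solution_tuples m xi eta Phi != finset.set0]%SET.
Proof.
move=> n0 tau_spread; rewrite -ProbC//; apply: le_Prob.
apply/fintype.subsetP => Phi; rewrite !inE negb_forall => /existsP[u].
rewrite negbK => h; apply/set0Pn; exists [ffun t => shift u (tau t)].
rewrite in_solution_tuples inE; apply/andP; split.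
  by apply/forallP => t; rewrite ffunE; move/forallP: h.
move: tau_spread; rewrite -(@spread_shift _ _ _ _ _ _ u).
by move=> /forallP h'; apply/forallP => t; move: (h' t) => /forallP h'';
  apply/forallP => l; rewrite !ffunE.
Qed.

(** A spread tuple lies in the ball of radius [xi * n] about its entry of index 0. That entry is
    counted both as the centre and as a point of the ball, hence the exponent [m]. *)
Lemma card_spread_le (R : realType) n m (xi eta B : R) : (0 < n)%N -> (0 < m)%N ->
  0 <= xi ->
  (forall t : assignment n,
    #|[set s : assignment n | (hamming s t)%:R <= xi * n%:R]%SET|%:R <= B) ->
  #|[set s : {ffun 'I_m -> assignment n} | spread xi eta s]%SET|%:R <= 2 ^+ n * B ^+ m.
Proof.
move=> n0 m0 xi0 hB; have n0' : 0 < n%:R :> R by rewrite ltr0n.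
pose ball t := [set s : assignment n | (hamming s t)%:R <= xi * n%:R]%SET.
apply: (@le_trans _ _ (\sum_(s0 : assignment n) (#|ball s0| ^ m)%:R)); last first.
  apply: (@le_trans _ _ (\sum_(s0 : assignment n) B ^+ m)).
    by apply: ler_sum => s0 _; rewrite natrX lerXn2r ?nnegrE// (le_trans _ (hB s0)).
  by rewrite sumr_const card_ffun card_bool card_ord -[leLHS]mulr_natl natrX.
have cE s0 : (#|ball s0| ^ m)%:R =
    \sum_(s : {ffun 'I_m -> assignment n})
      (s \in [set f | f \in ffun_on (mem (ball s0))]%SET)%:R :> R.
  by rewrite -natr_card -[m in LHS]card_ord -card_ffun_on cardsE.
rewrite (eq_bigr _ (fun s0 _ => cE s0)) natr_card exchange_big/=.
apply: ler_sum => s _; rewrite inE.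
case: (boolP (spread _ _ _)) => [h|_]; last exact: sumr_ge0.
pose t0 := Ordinal m0; rewrite (bigD1 (s t0))//= inE.
have -> : s \in ffun_on (mem (ball (s t0))).
  apply/ffun_onP => t; rewrite inE; have [->|tn] := eqVneq t t0.
    by rewrite hammingxx mulr_ge0// ltW.
  have /forallP/(_ t0)/forallP/(_ t)/implyP := h.
  move: tn; rewrite -val_eqE /= -lt0n => -> /(_ isT)/andP[_].
  by rewrite hammingC mulrC ler_pdivrMr.
by rewrite lerDl sumr_ge0.
Qed.

(** Union bound over the spread tuples. Each one is satisfying with probability
    [(1 - q) ^+ M <= expR (- q * M)], where the minimal distance [(xi - eta) * n] bounds its clause
    violation probability [q] from below. *)
Lemma Prob_solution_tuples_le (R : realType) n k M m (xi eta B : R) :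
  (0 < n)%N -> (0 < m)%N -> 0 <= xi -> xi <= 1 -> 0 <= eta ->
  (forall t : assignment n,
    #|[set s : assignment n | (hamming s t)%:R <= xi * n%:R]%SET|%:R <= B) ->
  Prob R [set Phi : formula n k M | solution_tuples m xi eta Phi != finset.set0]%SET <=
  2 ^+ n * B ^+ m *
    expR (- (m%:R * 2^-1 ^+ k - (m ^ 2)%:R * ((1 - (xi - eta)) / 2) ^+ k) * M%:R).
Proof.
move=> n0 m0 xi0 xi1 eta0 hB; have n0' : 0 < n%:R :> R by rewrite ltr0n.
set x := expR _.
have b0 : 0 <= (1 - (xi - eta)) / 2 by rewrite divr_ge0//; lra.
have px (s : {ffun 'I_m -> assignment n}) : spread xi eta s -> Prob R (satisfying k M s) <= x.
  move=> h; rewrite Prob_satisfying// /x expRM_natr.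
  rewrite lerXn2r ?nnegrE ?expR_ge0 ?subr_ge0 ?clause_prob_le1//.
  apply: le_trans (expR_ge1Dx _) _; rewrite ler_expR lerN2.
  apply: clause_prob_violating_ge; rewrite ?exprn_ge0// => t l tl.
  rewrite clause_prob_violating2// lerXn2r ?nnegrE ?b0 ?divr_ge0 ?subr_ge0//.
    by rewrite ler_pdivrMr// mul1r ler_nat hamming_le.
  rewrite ler_pM2r// lerD2l lerN2.
  wlog lt_tl : t l tl / (t < l)%N.
    by move=> hw; case: (ltngtP t l) => [|?|/val_inj e]; [exact: hw|
      rewrite hammingC; apply: hw; rewrite // eq_sym|rewrite e eqxx in tl].
  have /forallP/(_ t)/forallP/(_ l) := h.
  by rewrite lt_tl/= mulrC => /andP[].
apply: (@le_trans _ _ 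
  (\sum_(s in [set s : {ffun 'I_m -> assignment n} | spread xi eta s]%SET)
   Prob R (satisfying k M s))); last first.
  apply: (@le_trans _ _ 
    (\sum_(s in [set s : {ffun 'I_m -> assignment n} | spread xi eta s]%SET) x)).
    by apply: ler_sum => s; rewrite inE; exact: px.
  rewrite sumr_const -[leLHS]mulr_natl ler_pM2r ?expR_gt0//; exact: card_spread_le.
under [leRHS]eq_bigr do rewrite ProbE natr_card.
rewrite -mulr_suml ProbE natr_card ler_pM2r ?invr_gt0 ?ltr0n ?formula_gt0//.
rewrite exchange_big/=; apply: ler_sum => Phi _.
rewrite inE; case: (set0Pn _) => [[s hs]|_]/=; last exact: sumr_ge0.
move: hs; rewrite in_solution_tuples => /andP[hs hs'].
have sS : s \in [set s : {ffun 'I_m -> assignment n} | spread xi eta s]%SET.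
  by rewrite inE.
by rewrite (bigD1 s sS)/= hs lerDl sumr_ge0.
Qed.

(** * Asymptotic estimates *)

Section asymptotics.
Variable R : realType.
Implicit Types (gamma e : R).

Lemma small_balls e : 0 < e -> exists2 d : R, 0 < d <= 2^-1 &
  forall n (t : assignment n),
    #|[set s : assignment n | (hamming s t)%:R <= d * n%:R]%SET|%:R <= expR (e * n%:R).
Proof.
(* A smaller [e] gives a stronger bound, and [e <= 1] keeps the radius below [2^-1]. *)
wlog e1 : e / e <= 1.
  move=> hw e0; case: (lerP e 1) => [/hw|/ltW h]; first exact.
  have [//|//|d hd hB] := hw 1; exists d => // n t.
  by apply: le_trans (hB n t) _; rewrite ler_expR ler_wpM2r.
(* With [L = 2 / e] this radius makes [expR (L * r)] equal to [expR (e / 2 * n%:R)]; the other half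
   of the exponent pays for [expR (- L) <= e / 2] in each coordinate. *)
move=> e0; exists (e ^+ 2 / 4); first by apply/andP; split; nra.
move=> n t; have L0 : 0 <= 2 / e by rewrite divr_ge0// ltW.
apply: le_trans (@chernoff_ball R n t (2 / e) _ L0) _.
have -> : e * n%:R = 2 / e * (e ^+ 2 / 4 * n%:R) + e / 2 * n%:R.
  by field; rewrite gt_eqF.
rewrite expRD ler_pM2l ?expR_gt0// expRM_natr.
rewrite lerXn2r ?nnegrE ?addr_ge0 ?expR_ge0//.
apply: le_trans (expR_ge1Dx _); rewrite lerD2l.
rewrite expRN invf_ple ?posrE ?expR_gt0 ?divr_gt0//.
by rewrite invf_div; apply: le_trans (expR_ge1Dx _); rewrite lerDr.
Qed.

Lemma num_clauses_le gamma n k : 0 < gamma ->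
  (num_clauses gamma n k)%:R <= gamma * 2 ^+ k * ln 2 * n%:R.
Proof.
move=> g0; have l0 : 0 < ln 2 :> R by rewrite ln_gt0// ltr1n.
by rewrite truncn_le// /alpha !mulr_ge0 ?exprn_ge0// ltW.
Qed.

Lemma num_clauses_ge gamma n k :
  gamma * 2 ^+ k * ln 2 * n%:R - 1 <= (num_clauses gamma n k)%:R.
Proof. by rewrite lerBlDr natr1 ltW// truncnS_gt. Qed.

(** Weakens exponential decay to a multiple of [n%:R^-1], in which the error terms below are
    expressed. *)
Lemma expRN_le_inv (x : R) : 0 < x -> expR (- x) <= x^-1.
Proof.
move=> x0; rewrite expRN lef_pV2 ?posrE ?expR_gt0//.
by apply: le_trans (expR_ge1Dx _); rewrite lerDr.
Qed.

Lemma cvg_invn : (n%:R^-1 : R) @[n --> \oo] --> (0 : R).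
Proof.
apply/gtr0_cvgV0; last exact: cvgr_idn.
by exists 1%N => // n /=; rewrite ltr0n.
Qed.

Section large_clauses.
Variables (C : nat) (k : nat -> nat).
Hypothesis C0 : (0 < C)%N.
Hypothesis hk : forall n, (0 < n)%N -> C%:R * ln (n%:R : R) <= (k n)%:R.

Lemma cvg_clause_size : k n @[n --> \oo] --> \oo.
Proof.
apply/cvgnyPge => K.
have [N hN] : exists N : nat, expR K%:R <= N%:R :> R.
  by exists (Num.truncn (expR K%:R : R)).+1; exact/ltW/truncnS_gt.
exists N => // n /= Nn; rewrite -(ler_nat R).
have n0 : 0 < n%:R :> R.
  by apply: lt_le_trans (expR_gt0 K%:R) _; rewrite (le_trans hN)// ler_nat.
have n0' : (0 < n)%N by rewrite -(ltr_nat R).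
apply: le_trans (hk n n0').
apply: (@le_trans _ _ (ln (n%:R : R))).
  rewrite -[K%:R]expRK ler_ln ?posrE ?expR_gt0//.
  by rewrite (le_trans hN)// ler_nat.
by rewrite ler_peMl ?ler1n// ln_ge0// ler1n.
Qed.

Lemma near_expr_small (x e : R) : 0 <= x -> x < 1 -> 0 < e ->
  \forall n \near \oo, x ^+ k n <= e.
Proof.
move=> x0 x1 e0.
have h : x ^+ k n @[n --> \oo] --> (0 : R).
  apply: (@cvg_comp _ _ _ k (fun j => x ^+ j) _ _ _ cvg_clause_size).
  apply: cvg_expr.
  by rewrite ger0_norm.
exact: (cvgr_le _ h).
Qed.

End large_clauses.

(** * The regimes below and above the threshold *)

Lemma small_gamma_admissible gamma m : (0 < m)%N -> 0 < gamma -> m%:R * gamma < 1 ->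
  admissible m gamma.
Proof.
move=> m0 g0 mg xi eta eta0 exi xi2.
have l0 : 0 < ln 2 :> R by rewrite ln_gt0// ltr1n.
have m0' : 0 < m%:R :> R by rewrite ltr0n.
pose a := 1 - m%:R * gamma.
have a0 : 0 < a by rewrite subr_gt0.
(* Budget in units of [ln 2 * n]: the slack [a] pays [a / 4] for the balls through [e] and at most
   [a / 4] for the error [th] in the exponent of [(1 - q) ^- M]. The remaining [a / 2] is the decay
   rate [c]. *)
pose th := a / 4; pose e := a * ln 2 / 4; pose c := a * ln 2 / 2.
have th0 : 0 < th by rewrite divr_gt0.
have e0 : 0 < e by rewrite divr_gt0// mulr_gt0.
have c0 : 0 < c by rewrite divr_gt0// mulr_gt0.
have [d /andP[d0 d1] hB] := small_balls _ e0.
(* This constant gives [(1 - d) ^+ k n <= n%:R^-1 ^+ 2], while [M%:R * 2^-1 ^+ k n] is at most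
   linear in [n]; the far pairs then cost only [A * n%:R^-1] in the exponent. *)
exists (Num.truncn (2 / d)).+1 => k hk.
have hC : 2 / d <= (Num.truncn (2 / d)).+1%:R by rewrite ltW// truncnS_gt.
set C := (Num.truncn (2 / d)).+1 in hk hC.
pose A := 4 * (m ^ 2)%:R * gamma * ln 2.
pose g n : R := 1 - (expR (A * n%:R^-1) - 1 + (m ^ 2)%:R * c^-1 * n%:R^-1).
have gcvg : g n @[n --> \oo] --> (1 : R).
  rewrite -[X in _ --> X]subr0; apply: cvgB; first exact: cvg_cst.
  rewrite -[X in _ --> X]addr0; apply: cvgD.
    rewrite -[X in _ --> X](subrr (1 : R)); apply: cvgB; last exact: cvg_cst.
    rewrite -[X in _ --> X]expR0; apply: continuous_cvg; first exact: continuous_expR.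
    by rewrite -[X in _ --> X](mulr0 A); apply: cvgMr cvg_invn.
  by rewrite -[X in _ --> X](mulr0 ((m ^ 2)%:R * c^-1)); apply: cvgMr cvg_invn.
apply: (squeeze_cvgr _ gcvg (@cvg_cst _ _ _ _ _)).
have small (x : R) : 0 < x -> \forall n \near \oo, 2^-1 ^+ k n <= x.
  move=> x0; apply: (@near_expr_small C k isT hk) => //.
  by rewrite invf_lt1// ltr1n.
near=> n.
have n0 : (0 < n)%N by near: n; exists 1%N.
have n0' : 0 < n%:R :> R by rewrite ltr0n.
have hn : 2 ^+ m <= 2 * eta * n%:R.
  rewrite -ler_pdivrMl ?mulr_gt0//; near: n; exact: nbhs_infty_ger.
apply/andP; split; last exact: Prob_le1.
have [tau tau_spread] := exists_spread R n m xi eta n0 (lt_trans eta0 exi) xi2 hn.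
rewrite /prob_solution_tuples; set M := num_clauses gamma n (k n).
apply: le_trans (Prob_solution_tuples_ge _ _ _ _ _ _ _ _ n0 tau_spread); rewrite /g lerD2l lerN2.
set q := clause_prob R (violating (k n) tau).
have q0 : 0 <= q by exact: clause_prob_ge0.
have qm : q <= m%:R * 2^-1 ^+ k n by exact: clause_prob_violating_le.
have q_half : q <= 2^-1.
  apply: le_trans qm _; rewrite -ler_pdivlMl//; near: n; apply: small.
  by rewrite mulr_gt0 ?invr_gt0.
(* Equivalent to [q * (1 + th) <= th], from which [(1 - q)^-1 <= 1 + q * (1 + th)] follows. *)
have q_th : q <= th / (1 + th).
  apply: le_trans qm _; rewrite -ler_pdivlMl//; near: n; apply: small.
  by rewrite mulr_gt0 ?invr_gt0// divr_gt0// addr_gt0.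
have q1 : 0 < 1 - q by lra.
have MM : M%:R * 2^-1 ^+ k n <= gamma * ln 2 * n%:R.
  rewrite exprVn ler_pdivrMr ?exprn_gt0//.
  apply: le_trans (num_clauses_le _ _ _ g0) _; rewrite le_eqVlt.
  by apply/orP; left; apply/eqP; ring.
apply: le_trans (Prob_no_translate _ _ _ _ _ tau _ _ n0 (hB n) q_half (le_trans d1 _)) _.
  by rewrite invf_le1// ler1n.
rewrite -/q -/M; apply: lerD.
  rewrite lerD2r ler_expR exprMn mulrCA.
  have hd : (1 - d) ^+ k n <= n%:R^-1 ^+ 2.
    apply: (@le_trans _ _ (expR (- d) ^+ k n)).
      rewrite lerXn2r ?nnegrE ?expR_ge0//; first lra.
      exact: expR_ge1Dx.
    have -> : n%:R^-1 = expR (- ln n%:R) :> R by rewrite expRN lnK.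
    rewrite -!expRM_natr ler_expR !mulNr lerN2.
    have : d * (2 / d * ln n%:R) <= d * (k n)%:R.
      rewrite ler_pM2l//; apply: le_trans (hk n n0); rewrite ler_wpM2r//.
      by rewrite ln_ge0// ler1n.
    by rewrite mulrA mulrCA mulfV ?gt_eqF// mulr1 mulrC.
  have h1 : 0 <= (1 - d) ^+ k n by rewrite exprn_ge0//; lra.
  have := ler_pM _ h1 MM hd; rewrite mulr_ge0 ?exprn_ge0// => /(_ isT) h.
  have -> : A * n%:R^-1 = (4 * (m ^ 2)%:R) * (gamma * ln 2 * n%:R * n%:R^-1 ^+ 2).
    by rewrite /A; field; rewrite gt_eqF.
  apply: le_trans (ler_wpM2l _ h); last by rewrite mulr_ge0.
  by rewrite le_eqVlt; apply/orP; left; apply/eqP; ring.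
(* The term of the close pairs: apart from [(m ^ 2)%:R] it is at most [expR (- (c * n%:R))]. *)
rewrite -(mulrA _ c^-1) -2!(mulrA (m ^ 2)%:R) -(mulrA (expR _)) ler_wpM2l// -invfM.
apply: le_trans (expRN_le_inv _ _); last by rewrite mulr_gt0.
have V : (1 - q) ^- M <= expR (m%:R * (1 + th) * (gamma * ln 2 * n%:R)).
  apply: (@le_trans _ _ (expR (q * (1 + th)) ^+ M)).
    rewrite -exprVn lerXn2r ?nnegrE ?expR_ge0 ?invr_ge0 ?(ltW q1)//.
    apply: le_trans (expR_ge1Dx _); rewrite -div1r ler_pdivrMr//.
    move: q_th; rewrite ler_pdivlMr ?addr_gt0// => q_th.
    have : 0 <= q * (th - q * (1 + th)) by rewrite mulr_ge0// subr_ge0.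
    nra.
  rewrite -expRM_natr ler_expR.
  apply: (@le_trans _ _ (m%:R * 2^-1 ^+ k n * (1 + th) * M%:R)).
    by rewrite ler_wpM2r// ler_wpM2r// addr_ge0// ltW.
  have -> : m%:R * 2^-1 ^+ k n * (1 + th) * M%:R =
     m%:R * (1 + th) * (M%:R * 2^-1 ^+ k n) by ring.
  by rewrite ler_wpM2l// mulr_ge0// addr_ge0// ltW.
have -> : 2^-1 ^+ n = expR (- ln 2 * n%:R) :> R.
  by rewrite expRM_natr expRN lnK// posrE.
apply: le_trans (ler_wpM2l (expR_ge0 _) (ler_wpM2l (expR_ge0 _) V)) _.
rewrite -!expRD ler_expR.
have -> : - (c * n%:R) = (ln 2 * n%:R) * (- (a / 2)) by rewrite /c; ring.
have -> : e * n%:R + (- ln 2 * n%:R + m%:R * (1 + th) * (gamma * ln 2 * n%:R)) =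
  (ln 2 * n%:R) * (a / 4 - 1 + m%:R * gamma * (1 + th)) by rewrite /e; ring.
rewrite ler_wpM2l ?mulr_ge0 ?(ltW l0)//.
have : m%:R * gamma * th <= th by rewrite ler_piMl// ltW.
by rewrite /a /th /a; lra.
Unshelve. all: by end_near.
Qed.

Lemma large_gamma_inadmissible gamma m : (0 < m)%N -> 0 < gamma -> 1 < m%:R * gamma ->
  inadmissible m gamma.
Proof.
move=> m0 g0 mg.
have l0 : 0 < ln 2 :> R by rewrite ln_gt0// ltr1n.
have m0' : 0 < m%:R :> R by rewrite ltr0n.
pose a := m%:R * gamma - 1.
have a0 : 0 < a by rewrite subr_gt0.
(* Budget in units of [ln 2 * n]: [a / 4] pays for the [m] balls through [e * m%:R], [a / 4] for the
   Bonferroni correction through [th * gamma], and [a / 2] is left as the rate [c]. *)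
pose e := a * ln 2 / (4 * m%:R); pose th := a / (4 * gamma); pose c := a * ln 2 / 2.
have e0 : 0 < e by rewrite divr_gt0 ?mulr_gt0.
have th0 : 0 < th by rewrite divr_gt0 ?mulr_gt0.
have c0 : 0 < c by rewrite divr_gt0// mulr_gt0.
have [d /andP[d0 d1] hB] := small_balls _ e0.
(* Distances lie between [d / 2 * n] and [d * n]: the upper end limits the number of candidates, the
   lower end makes joint violations of a clause negligible against [2^-1 ^+ k n]. *)
exists d, (d / 2); split; first by split=> //; lra.
exists 1%N => k hk.
(* The factor [expR m%:R] absorbs the floor in [num_clauses]: losing at most one clause costs at
   most [m%:R * 2^-1 ^+ k n <= m%:R] in the exponent. *)
pose g n : R := expR m%:R * c^-1 * n%:R^-1.
have gcvg : g n @[n --> \oo] --> (0 : R).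
  by rewrite -[X in _ --> X](mulr0 (expR m%:R * c^-1)); apply: cvgMr cvg_invn.
apply: (squeeze_cvgr _ (@cvg_cst _ _ _ _ _) gcvg).
near=> n.
have n0 : (0 < n)%N by near: n; exists 1%N.
have n0' : 0 < n%:R :> R by rewrite ltr0n.
rewrite /prob_solution_tuples; set M := num_clauses gamma n (k n).
apply/andP; split; first by rewrite ProbE divr_ge0.
have small : (m ^ 2)%:R * (1 - (d - d / 2)) ^+ k n <= th.
  have m2 : 0 < (m ^ 2)%:R :> R by rewrite ltr0n expn_gt0 m0.
  rewrite -ler_pdivlMl//; near: n.
  apply: (@near_expr_small 1 k isT hk); [lra|lra|].
  by rewrite mulr_gt0 ?invr_gt0// ltr0n expn_gt0 m0.
apply: le_trans (Prob_solution_tuples_le _ _ _ _ _ _ _ _ n0 m0 (ltW d0) _ _ (hB n)) _; [lra|lra|].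
have M1 := num_clauses_le gamma n (k n) g0; have M2 := num_clauses_ge gamma n (k n).
rewrite -/M in M1 M2.
have p0 : 0 < 2^-1 ^+ k n :> R by rewrite exprn_gt0.
have pV : 2^-1 ^+ k n * 2 ^+ k n = 1 :> R by rewrite -exprMn mulVf ?expr1n// pnatr_eq0.
have p1 : 2^-1 ^+ k n <= 1 :> R by rewrite exprn_ile1// invf_le1// ler1n.
apply: (@le_trans _ _ (expR (m%:R - c * n%:R))); last first.
  rewrite expRD /g -mulrA ler_pM2l ?expR_gt0// -invfM.
  by apply: expRN_le_inv; rewrite mulr_gt0.
have -> : 2 ^+ n = expR (ln 2 * n%:R) :> R by rewrite expRM_natr lnK// posrE.
rewrite -expRM_natr -!expRD ler_expR exprMn.
set u := (1 - (d - d / 2)) ^+ k n in small *.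
set p := 2^-1 ^+ k n in p0 pV p1 *.
have pE : p * (gamma * 2 ^+ k n * ln 2 * n%:R) = gamma * ln 2 * n%:R.
  transitivity (p * 2 ^+ k n * (gamma * ln 2 * n%:R)); first by ring.
  by rewrite pV mul1r.
have h1 : p * M%:R <= gamma * ln 2 * n%:R by rewrite -pE ler_pM2l.
have h2 : gamma * ln 2 * n%:R - 1 <= p * M%:R.
  have := ler_wpM2l (ltW p0) M2; rewrite mulrBr pE; lra.
have h3 : (m ^ 2)%:R * u * (p * M%:R) <= a / 4 * ln 2 * n%:R.
  apply: le_trans (ler_wpM2r _ small) _; first by rewrite mulr_ge0// ltW.
  apply: le_trans (ler_wpM2l (ltW th0) h1) _.
  by rewrite le_eqVlt; apply/orP; left; apply/eqP; rewrite /th; field; rewrite gt_eqF.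
have h4 := ler_wpM2l (ltW m0') h2.
have -> : e * n%:R * m%:R = a / 4 * ln 2 * n%:R.
  by rewrite /e; field; rewrite gt_eqF.
have -> : - (m%:R * p - (m ^ 2)%:R * (u * p)) * M%:R =
  (m ^ 2)%:R * u * (p * M%:R) - m%:R * (p * M%:R) by ring.
have h5 : c * n%:R = a / 2 * ln 2 * n%:R by rewrite /c; ring.
have h6 : m%:R * (gamma * ln 2 * n%:R - 1) = ln 2 * n%:R + a * ln 2 * n%:R - m%:R.
  by rewrite /a; ring.
rewrite h6 in h4; lra.
Unshelve. all: by end_near.
Qed.

(** Some sequence [k] meets both lower bounds; along it the same probability would tend to 0 and to
    1. *)
Lemma admissible_inadmissible gamma m : admissible m gamma -> ~ inadmissible m gamma.
Proof.
move=> adm [xi [eta [[eta0 exi xi2] [C hC]]]].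
have [C' hC'] := adm xi eta eta0 exi xi2.
pose k n := (Num.truncn ((C%:R + C'%:R) * ln (n%:R : R))).+1.
have lek n : (0 < n)%N -> (C%:R + C'%:R) * ln (n%:R : R) <= (k n)%:R.
  by move=> _; exact/ltW/truncnS_gt.
have c0 := hC k; have c1 := hC' k.
have : (0 : R) = 1.
  apply: (@cvg_unique _ _
    (prob_solution_tuples gamma m xi eta n (k n) @[n --> \oo])) => //.
    apply: c0 => n n0; apply: le_trans (lek n n0).
    by rewrite ler_wpM2r ?lerDl// ln_ge0// ler1n.
  apply: c1 => n n0; apply: le_trans (lek n n0).
  by rewrite ler_wpM2r ?lerDr// ln_ge0// ler1n.
by move/eqP; rewrite eq_sym oner_eq0.
Qed.

End asymptotics.

(* Outside their domain (has_sup, has_inf) the library's sup and inf are 0,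
   so these equations force both sets to be nonempty and bounded. *)
Theorem theorem3p5 (R : realType) (m : nat) (hm : (0 < m)%N) :
  sup [set gamma : R | 0 < gamma /\ admissible m gamma] = 1 / m%:R /\
  1 / m%:R = inf [set gamma : R | 0 < gamma /\ inadmissible m gamma].
Proof.
have m0 : 0 < m%:R :> R by rewrite ltr0n.
have i0 : 0 < 1 / m%:R :> R by rewrite divr_gt0.
have adm (g : R) : 0 < g -> g < 1 / m%:R -> admissible m g.
  by move=> g0; rewrite ltr_pdivlMr// mulrC; apply: small_gamma_admissible.
have inadm (g : R) : 1 / m%:R < g -> inadmissible m g.
  move=> h; apply: large_gamma_inadmissible => //; first exact: lt_trans h.
  by move: h; rewrite ltr_pdivrMr// mulrC.
have adm_ub : ubound [set gamma : R | 0 < gamma /\ admissible m gamma] (1 / m%:R).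
  move=> g [_ hg]; rewrite leNgt; apply/negP => /inadm.
  exact: admissible_inadmissible.
have inadm_lb : lbound [set gamma : R | 0 < gamma /\ inadmissible m gamma] (1 / m%:R).
  move=> g [g0 hg]; rewrite leNgt; apply/negP => /(adm _ g0) h.
  exact: admissible_inadmissible hg.
split; apply/eqP; rewrite eq_le; apply/andP; split.
- apply: ge_sup => //; exists (1 / m%:R / 2); split; first by rewrite divr_gt0.
  by apply: adm; rewrite ?divr_gt0//; lra.
- have le_adm (g : R) : 0 < g -> g < 1 / m%:R ->
      g <= sup [set gamma : R | 0 < gamma /\ admissible m gamma].
    move=> g0 h; apply: ub_le_sup; first by exists (1 / m%:R).
    by split=> //; apply: adm.
  set S := sup _ in le_adm *; rewrite leNgt; apply/negP => h.
  (* Makes [S] positive, so that the midpoint of [S] and [1 / m%:R] is an admissible value. *)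
  have h2 : 1 / m%:R / 2 <= S by apply: le_adm; rewrite ?divr_gt0//; lra.
  have : (S + 1 / m%:R) / 2 <= S by apply: le_adm; lra.
  lra.
- apply: lb_le_inf => //; exists (1 / m%:R + 1); split; first by rewrite addr_gt0.
  by apply: inadm; rewrite ltrDl.
- apply/ler_addgt0Pr => e e0; apply: ge_inf; first by exists (1 / m%:R).
  by split; [rewrite addr_gt0|apply: inadm; rewrite ltrDl].
Qed.
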